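(* Let $X$ be a CBB$(0)$ space, let $Y$ be a complete CAT$(0)$ space and let $A \subseteq X$ be nonempty. Then there exists a continuous mapping $\beta : \mathcal{L}(A,Y) \to \mathcal{L}(X,Y)$ such that for all $g \in \mathcal{L}(A,Y)$, $\beta(g)(a) = g(a)$ for every $a \in A$ and $\mathrm{Lip}(\beta(g),X) = \mathrm{Lip}(g,A)$.
   Context: A geodesic space is CAT$(0)$ if for every geodesic triangle, distances between points on the triangle are $\le$ distances between corresponding points of its Euclidean comparison triangle; it is CBB$(0)$ if the reversed inequality ($\ge$) holds. $\mathcal{L}(A,Y)$ is the set of bounded Lipschitz maps $A\to Y$ with the supremum metric $d_\infty(f,g)=\sup_{x\in A}d_Y(f(x),g(x))$; continuity refers to these metrics. $\mathrm{Lip}(f,B)=\sup\{d_Y(f(x),f(y))/d(x,y):x,y\in B,x\ne y\}$. *)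

(* Defs.v *)
From Stdlib Require Import Reals.
Open Scope R_scope.

Record MetricSpace := {
  mcarrier :> Type;
  mdist : mcarrier -> mcarrier -> R;
  mdist_ge0 : forall x y, 0 <= mdist x y;
  mdist_eq0 : forall x y, mdist x y = 0 <-> x = y;
  mdist_sym : forall x y, mdist x y = mdist y x;
  mdist_tri : forall x y z, mdist x z <= mdist x y + mdist y z
}.
Arguments mdist {_} _ _.

Definition geodesic {X : MetricSpace} (g : R -> X) (x y : X) : Prop :=
  g 0 = x /\ g 1 = y /\
  forall s t, 0 <= s <= 1 -> 0 <= t <= 1 ->
    mdist (g s) (g t) = Rabs (s - t) * mdist x y.

Definition geodesic_space (X : MetricSpace) : Prop :=
  forall x y : X, exists g : R -> X, geodesic g x y.

Definition eucl (p q : R * R) : R :=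
  sqrt ((fst p - fst q) ^ 2 + (snd p - snd q) ^ 2).
Definition eseg (p q : R * R) (t : R) : R * R :=
  ((1 - t) * fst p + t * fst q, (1 - t) * snd p + t * snd q).

Definition triangle_comparison (X : MetricSpace) (cmp : R -> R -> Prop) : Prop :=
  forall (p q r : X) (g1 g2 g3 : R -> X),
    geodesic g1 p q -> geodesic g2 q r -> geodesic g3 r p ->
    forall p' q' r' : R * R,
      eucl p' q' = mdist p q -> eucl q' r' = mdist q r -> eucl r' p' = mdist r p ->
      let G := fun i : nat => match i with 0%nat => g1 | 1%nat => g2 | _ => g3 end in
      let G' := fun i : nat => match i with
                               | 0%nat => eseg p' q' | 1%nat => eseg q' r'
                               | _ => eseg r' p' end in
      forall (i j : nat) (s t : R), (i < 3)%nat -> (j < 3)%nat ->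
        0 <= s <= 1 -> 0 <= t <= 1 ->
        cmp (mdist (G i s) (G j t)) (eucl (G' i s) (G' j t)).

Definition CAT0 (X : MetricSpace) : Prop :=
  geodesic_space X /\ triangle_comparison X Rle.
Definition CBB0 (X : MetricSpace) : Prop :=
  geodesic_space X /\ triangle_comparison X Rge.

Definition complete (Y : MetricSpace) : Prop :=
  forall u : nat -> Y,
    (forall eps, 0 < eps -> exists N, forall m n, (N <= m)%nat -> (N <= n)%nat ->
        mdist (u m) (u n) < eps) ->
    exists l : Y, forall eps, 0 < eps -> exists N, forall n, (N <= n)%nat ->
        mdist (u n) l < eps.

Definition bounded {S : Type} {Y : MetricSpace} (f : S -> Y) : Prop :=
  exists (y0 : Y) (M : R), forall x, mdist (f x) y0 <= M.
Definition lipschitz {S : Type} (dS : S -> S -> R) {Y : MetricSpace} (f : S -> Y) : Prop :=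
  exists L : R, forall x y, mdist (f x) (f y) <= L * dS x y.
Definition Lmap (S : Type) (dS : S -> S -> R) (Y : MetricSpace) : Type :=
  { f : S -> Y | bounded f /\ lipschitz dS f }.

Definition sub {X : MetricSpace} (A : X -> Prop) : Type := { x : X | A x }.
Definition subdist {X : MetricSpace} (A : X -> Prop) (a b : sub A) : R :=
  mdist (proj1_sig a) (proj1_sig b).

Definition dinf_le {S : Type} {Y : MetricSpace} (f g : S -> Y) (c : R) : Prop :=
  forall x, mdist (f x) (g x) <= c.

Definition sup_continuous {S1 S2 : Type} {d1 : S1 -> S1 -> R} {d2 : S2 -> S2 -> R}
  {Y : MetricSpace} (beta : Lmap S1 d1 Y -> Lmap S2 d2 Y) : Prop :=
  forall g eps, 0 < eps -> exists delta, 0 < delta /\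
    forall h, dinf_le (proj1_sig g) (proj1_sig h) delta ->
      dinf_le (proj1_sig (beta g)) (proj1_sig (beta h)) eps.

(** Lip(f,B): the supremum of the difference quotients
    (with the convention sup of the empty set = 0, hence the extra 0). *)
Definition lip_ratios {S : Type} (dS : S -> S -> R) {Y : MetricSpace} (f : S -> Y) : R -> Prop :=
  fun r => r = 0 \/ exists x y, x <> y /\ r = mdist (f x) (f y) / dS x y.
Definition is_Lip {S : Type} (dS : S -> S -> R) {Y : MetricSpace} (f : S -> Y) (L : R) : Prop :=
  is_lub (lip_ratios dS f) L.

(* Main.v *)
Require Import Defs.
From mathcomp Require boolp classical_sets.
From Stdlib Require Import Reals Lra Lia List Permutation Arith Classical.
Open Scope R_scope.

(** Let [T] be the set of bounded Lipschitz maps [A -> Y].  All extensions are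
    constructed at once, as a map [F] on [X * T] extending the evaluation map on
    [A * T] and satisfying, for all [k] in [T],
      [d (F x g) (F x' h) ^ 2 <= Lip k ^ 2 * d x x' ^ 2 + rho g k + rho h k]
    where [rho] is a metric on [T], continuous for the sup metric and weighted by the
    size of the maps so that evaluation itself satisfies these constraints.  Taking
    [k = g = h] gives the Lipschitz constant, [k = g] and [x = x'] the continuity in
    [g], and [k] constant the boundedness.

    By Zorn's lemma it suffices to choose one more value, i.e. to find a common point
    of a family of balls in [Y] with centres [y i] and squared radii [c i].  In a complete
    CAT(0) space such a point exists as soon as
      [sum_ij l i * l j * d (y i) (y j) ^ 2 <= 2 * sum_i l i * c i]
    for all convex weights [l].  The metric part of the constraints satisfies this by the
    triangle inequality for [rho], and the part coming from [X] by the
    Lang-Schroeder-Sturm inequality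
      [sum_ij l i * l j * d (x i) (x j) ^ 2 <= 2 * sum_i l i * d p (x i) ^ 2],
    proved by merging two of the points at an infinitesimal scale around [p], where the
    triangle they form with [p] becomes flat. *)

(** * Euclidean comparison triangles and the two curvature inequalities *)

Lemma sqr_le_inv (x y : R) : 0 <= y -> x ^ 2 <= y ^ 2 -> x <= y.
Proof. intros Hy H. nra. Qed.

Lemma eucl_sqr (p q : R * R) :
  eucl p q ^ 2 = (fst p - fst q) ^ 2 + (snd p - snd q) ^ 2.
Proof.
  unfold eucl. rewrite pow2_sqrt; [reflexivity|].
  apply Rplus_le_le_0_compat; apply pow2_ge_0.
Qed.

Lemma eucl_ge0 (p q : R * R) : 0 <= eucl p q.
Proof. apply sqrt_pos. Qed.

Lemma eucl_eq (p q : R * R) (a : R) :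
  0 <= a -> (fst p - fst q) ^ 2 + (snd p - snd q) ^ 2 = a ^ 2 -> eucl p q = a.
Proof.
  intros Ha H. unfold eucl. rewrite H.
  replace (a ^ 2) with (a * a) by ring. apply sqrt_square, Ha.
Qed.

(** The law of cosines places the third vertex at abscissa [u] along the first side; Heron's
    factorisation and the triangle inequalities make its squared height nonnegative. *)
Lemma comparison_triangle (a b c : R) :
  0 <= a -> 0 <= b -> 0 <= c -> a <= b + c -> b <= a + c -> c <= a + b ->
  exists p q r : R * R, eucl p q = a /\ eucl q r = b /\ eucl r p = c.
Proof.
  intros Ha Hb Hc H1 H2 H3.
  destruct (Req_dec a 0) as [E|E].
  - assert (b = c) by lra. subst.
    exists (0, 0), (0, 0), (c, 0).
    repeat split; apply eucl_eq; simpl; auto; ring.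
  - set (u := (a ^ 2 + c ^ 2 - b ^ 2) / (2 * a)).
    assert (Hu : 2 * a * u = a ^ 2 + c ^ 2 - b ^ 2) by (unfold u; field; auto).
    assert (Hv : 0 <= c ^ 2 - u ^ 2).
    { assert (P : 0 <= ((a + c) ^ 2 - b ^ 2) * (b ^ 2 - (a - c) ^ 2)).
      { apply Rmult_le_pos; nra. }
      assert (Q : ((a + c) ^ 2 - b ^ 2) * (b ^ 2 - (a - c) ^ 2)
                  = (2 * a) ^ 2 * (c ^ 2 - u ^ 2)).
      { replace ((2 * a) ^ 2 * (c ^ 2 - u ^ 2))
          with ((2 * a * c) ^ 2 - (2 * a * u) ^ 2) by ring.
        rewrite Hu. ring. }
      rewrite Q in P. apply Rnot_lt_le. intro N. assert (0 < (2 * a) ^ 2) by nra. nra. }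
    assert (Hs := pow2_sqrt _ Hv).
    exists (0, 0), (a, 0), (u, sqrt (c ^ 2 - u ^ 2)).
    repeat split; apply eucl_eq; cbn [fst snd]; auto.
    + ring.
    + replace ((0 - sqrt (c ^ 2 - u ^ 2)) ^ 2) with (sqrt (c ^ 2 - u ^ 2) ^ 2) by ring.
      rewrite Hs. nra.
    + replace ((sqrt (c ^ 2 - u ^ 2) - 0) ^ 2) with (sqrt (c ^ 2 - u ^ 2) ^ 2) by ring.
      rewrite Hs. ring.
Qed.

Lemma mdist_refl {X : MetricSpace} (x : X) : mdist x x = 0.
Proof. apply mdist_eq0. reflexivity. Qed.

(** Of the comparison axiom only the case of a vertex and a point of the opposite side is extracted;
    [e] is the Euclidean distance, given by Stewart's theorem. Leaving [cmp] abstract serves both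
    curvature signs. *)
Lemma vertex_comparison (X : MetricSpace) (cmp : R -> R -> Prop) :
  geodesic_space X -> triangle_comparison X cmp ->
  forall (p q w : X) (g : R -> X) (t : R), geodesic g p q -> 0 <= t <= 1 ->
  exists e, 0 <= e /\
    e ^ 2 = (1 - t) * mdist w p ^ 2 + t * mdist w q ^ 2 - t * (1 - t) * mdist p q ^ 2 /\
    cmp (mdist w (g t)) e.
Proof.
  intros HG HC p q w g t Hg Ht.
  destruct (HG q w) as [g2 Hg2]. destruct (HG w p) as [g3 Hg3].
  destruct (comparison_triangle (mdist p q) (mdist q w) (mdist w p))
    as (p' & q' & w' & E1 & E2 & E3); try apply mdist_ge0.
  - rewrite (mdist_sym _ q w), (mdist_sym _ w p), Rplus_comm. apply mdist_tri.
  - rewrite (mdist_sym _ p q), (mdist_sym _ w p). apply mdist_tri.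
  - rewrite (mdist_sym _ w p). apply mdist_tri.
  - specialize (HC p q w g g2 g3 Hg Hg2 Hg3 p' q' w' E1 E2 E3 2%nat 0%nat 0 t).
    simpl in HC. replace (g3 0) with w in HC by (symmetry; apply Hg3).
    exists (eucl (eseg w' p' 0) (eseg p' q' t)).
    split; [apply eucl_ge0|]. split.
    + rewrite (mdist_sym _ w q), <- E1, <- E2, <- E3, !eucl_sqr.
      unfold eseg; cbn [fst snd]. ring.
    + apply HC; lia || lra.
Qed.

Lemma CAT0_convex (Y : MetricSpace) : CAT0 Y ->
  forall (p q w : Y) (g : R -> Y) (t : R), geodesic g p q -> 0 <= t <= 1 ->
  mdist w (g t) ^ 2 <=
    (1 - t) * mdist w p ^ 2 + t * mdist w q ^ 2 - t * (1 - t) * mdist p q ^ 2.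
Proof.
  intros [HG HC] p q w g t Hg Ht.
  destruct (vertex_comparison Y Rle HG HC p q w g t Hg Ht) as (e & He & <- & Hle).
  apply pow_incr. split; [apply mdist_ge0|exact Hle].
Qed.

Lemma CBB0_concave (X : MetricSpace) : CBB0 X ->
  forall (p q w : X) (g : R -> X) (t : R), geodesic g p q -> 0 <= t <= 1 ->
  (1 - t) * mdist w p ^ 2 + t * mdist w q ^ 2 - t * (1 - t) * mdist p q ^ 2 <=
    mdist w (g t) ^ 2.
Proof.
  intros [HG HC] p q w g t Hg Ht.
  destruct (vertex_comparison X Rge HG HC p q w g t Hg Ht) as (e & He & <- & Hle).
  apply pow_incr. split; [exact He|apply Rge_le, Hle].
Qed.

(** * Weighted finite sums and quadratic forms *)

Definition lsum {I : Type} (l : list I) (f : I -> R) : R :=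
  fold_right (fun i s => f i + s) 0 l.

Lemma lsum_app {I : Type} (l1 l2 : list I) (f : I -> R) :
  lsum (l1 ++ l2) f = lsum l1 f + lsum l2 f.
Proof. induction l1 as [|i l IH]; simpl; [|rewrite IH]; ring. Qed.

Lemma lsum_map {I J : Type} (h : I -> J) (l : list I) (f : J -> R) :
  lsum (map h l) f = lsum l (fun i => f (h i)).
Proof. induction l as [|i l IH]; simpl; [|rewrite IH]; reflexivity. Qed.

Lemma lsum_perm {I : Type} (l l' : list I) (f : I -> R) :
  Permutation l l' -> lsum l f = lsum l' f.
Proof. induction 1; simpl; lra. Qed.

Lemma lsum_le {I : Type} (l : list I) (f g : I -> R) :
  (forall i, In i l -> f i <= g i) -> lsum l f <= lsum l g.
Proof.
  induction l as [|i l IH]; simpl; intros H; [lra|].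
  apply Rplus_le_compat; [apply H; auto|apply IH; intros; apply H; auto].
Qed.

Lemma lsum_ext {I : Type} (l : list I) (f g : I -> R) :
  (forall i, In i l -> f i = g i) -> lsum l f = lsum l g.
Proof. intros H. apply Rle_antisym; apply lsum_le; intros i Hi; rewrite H; auto; lra. Qed.

Lemma lsum_plus {I : Type} (l : list I) (f g : I -> R) :
  lsum l (fun i => f i + g i) = lsum l f + lsum l g.
Proof. induction l as [|i l IH]; simpl; [|rewrite IH]; ring. Qed.

Lemma lsum_scal {I : Type} (c : R) (l : list I) (f : I -> R) :
  lsum l (fun i => c * f i) = c * lsum l f.
Proof. induction l as [|i l IH]; simpl; [|rewrite IH]; ring. Qed.

Lemma lsum_ge0 {I : Type} (l : list I) (f : I -> R) :
  (forall i, In i l -> 0 <= f i) -> 0 <= lsum l f.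
Proof.
  intros H. replace 0 with (lsum l (fun _ => 0 * 0)) by (rewrite lsum_scal; ring).
  apply lsum_le. intros i Hi. rewrite Rmult_0_l. auto.
Qed.

(** Finitely supported weights are lists of pairs of a weight and an index. Indices may repeat, so
    concatenation adds weights. *)
Definition nonneg_weights {I : Type} (l : list (R * I)) : Prop :=
  forall a, In a l -> 0 <= fst a.

Definition qform {I : Type} (K : I -> I -> R) (l : list (R * I)) : R :=
  lsum l (fun a => lsum l (fun b => fst a * fst b * K (snd a) (snd b))).

Lemma qform_cons {I : Type} (K : I -> I -> R) (a : R * I) (l : list (R * I)) :
  (forall i j, K i j = K j i) ->
  qform K (a :: l) = fst a ^ 2 * K (snd a) (snd a)
    + 2 * fst a * lsum l (fun b => fst b * K (snd a) (snd b)) + qform K l.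
Proof.
  intros HK. unfold qform. simpl. rewrite lsum_plus.
  rewrite (lsum_ext l (fun b => fst a * fst b * K (snd a) (snd b))
             (fun b => fst a * (fst b * K (snd a) (snd b)))) by (intros; ring).
  rewrite (lsum_ext l (fun b => fst b * fst a * K (snd b) (snd a))
             (fun b => fst a * (fst b * K (snd a) (snd b)))).
  - rewrite lsum_scal. ring.
  - intros b _. rewrite (HK (snd b)). ring.
Qed.

Lemma qform_map {I J : Type} (K : J -> J -> R) (h : I -> J) (l : list (R * I)) :
  qform K (map (fun a => (fst a, h (snd a))) l) = qform (fun i j => K (h i) (h j)) l.
Proof.
  unfold qform. rewrite lsum_map. apply lsum_ext. intros a _. apply lsum_map.
Qed.

Lemma qform_perm {I : Type} (K : I -> I -> R) (l l' : list (R * I)) :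
  Permutation l l' -> qform K l = qform K l'.
Proof.
  intros H. unfold qform. rewrite (lsum_perm _ _ _ H).
  apply lsum_ext. intros a _. apply lsum_perm, H.
Qed.

Lemma qform_le {I : Type} (K K' : I -> I -> R) (l : list (R * I)) :
  nonneg_weights l -> (forall i j, K i j <= K' i j) -> qform K l <= qform K' l.
Proof.
  intros Hl H. apply lsum_le. intros a Ha. apply lsum_le. intros b Hb.
  apply Rmult_le_compat_l; [apply Rmult_le_pos; auto|apply H].
Qed.

Lemma qform_plus {I : Type} (K K' : I -> I -> R) (l : list (R * I)) :
  qform (fun i j => K i j + K' i j) l = qform K l + qform K' l.
Proof.
  unfold qform. rewrite <- lsum_plus. apply lsum_ext. intros a _.
  rewrite <- lsum_plus. apply lsum_ext. intros b _. ring.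
Qed.

Lemma qform_scal {I : Type} (c : R) (K : I -> I -> R) (l : list (R * I)) :
  qform (fun i j => c * K i j) l = c * qform K l.
Proof.
  unfold qform. rewrite <- lsum_scal. apply lsum_ext. intros a _.
  rewrite <- lsum_scal. apply lsum_ext. intros b _. ring.
Qed.

Lemma qform_separate {I : Type} (f : I -> R) (l : list (R * I)) :
  lsum l fst = 1 ->
  qform (fun i j => f i + f j) l = 2 * lsum l (fun a => fst a * f (snd a)).
Proof.
  intros H1. unfold qform.
  rewrite (lsum_ext l _ (fun a => fst a * f (snd a)
             + lsum l (fun b => fst b * f (snd b)) * fst a)).
  - rewrite lsum_plus, lsum_scal, H1. ring.
  - intros a _.
    rewrite (lsum_ext l _ (fun b => fst a * f (snd a) * fst b
               + fst a * (fst b * f (snd b)))) by (intros; ring).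
    rewrite lsum_plus, !lsum_scal, H1. ring.
Qed.

Definition copositive {I : Type} (K : I -> I -> R) : Prop :=
  forall l, nonneg_weights l -> 0 <= qform K l.

Lemma exists_minimal {I : Type} (c : I -> R) (i : I) (l : list I) :
  exists a, In a (i :: l) /\ forall b, In b (i :: l) -> c a <= c b.
Proof.
  revert i. induction l as [|j l IH]; intros i.
  - exists i. split; [left; auto|]. intros b [<-|[]]. lra.
  - destruct (IH j) as (a & Ha & Hm).
    destruct (Rle_dec (c i) (c a)) as [H|H].
    + exists i. split; [left; auto|]. intros b [<-|Hb]; [lra|].
      specialize (Hm b Hb). lra.
    + exists a. split; [right; auto|]. intros b [<-|Hb]; [lra|auto].
Qed.

(* Layer-cake: subtracting the smallest value [m] of [c] splits the kernel into
   [m * K] and one in which the index realising the minimum no longer occurs. *)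
Lemma copositive_min {I : Type} (K : I -> I -> R) (c : I -> R) :
  (forall i j, K i j = K j i) -> copositive K -> (forall i, 0 <= c i) ->
  copositive (fun i j => Rmin (c i) (c j) * K i j).
Proof.
  intros HK HP Hc l Hl.
  (* Nonnegativity of [c] is kept only on the entries of [l]: the shifted function [c'] may be
     negative elsewhere. *)
  assert (Hcl : forall a, In a l -> 0 <= c (snd a)) by auto.
  clear Hc. remember (length l) as n eqn:En.
  revert c l En Hl Hcl. induction n as [|n IH]; intros c l En Hl Hcl.
  - destruct l; [|discriminate]. unfold qform. simpl. lra.
  - destruct l as [|a0 l0]; [discriminate|].
    destruct (exists_minimal (fun a => c (snd a)) a0 l0) as (a & Ha & Hm).
    set (l := a0 :: l0) in *.
    destruct (in_split _ _ Ha) as (l1 & l2 & El).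
    assert (Hp : Permutation l (a :: l1 ++ l2))
      by (rewrite El; symmetry; apply Permutation_middle).
    assert (Hin : forall b, In b (l1 ++ l2) -> In b l).
    { intros b Hb. apply (Permutation_in _ (Permutation_sym Hp)). right; auto. }
    set (c' := fun i => c i - c (snd a)).
    assert (H1 : qform (fun i j => Rmin (c i) (c j) * K i j) l =
                 c (snd a) * qform K l + qform (fun i j => Rmin (c' i) (c' j) * K i j) l).
    { rewrite <- qform_scal, <- qform_plus. unfold qform.
      apply lsum_ext; intros u _; apply lsum_ext; intros v _.
      unfold c', Rmin. destruct Rle_dec; destruct Rle_dec; try lra; ring. }
    rewrite H1, (qform_perm (fun i j => Rmin (c' i) (c' j) * K i j) _ _ Hp), qform_cons
      by (intros i j; rewrite Rmin_comm, HK; reflexivity).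
    assert (E0 : forall i, 0 <= c' i -> Rmin (c' (snd a)) (c' i) = 0).
    { intros i Hi. unfold c' at 1. rewrite Rminus_diag. apply Rmin_left, Hi. }
    assert (Hc' : forall b, In b l -> 0 <= c' (snd b)).
    { intros b Hb. unfold c'. specialize (Hm b Hb). simpl in Hm. lra. }
    rewrite (E0 (snd a)) by auto.
    rewrite (lsum_ext _ _ (fun _ => 0 * 0)), lsum_scal by (intros b Hb; rewrite E0 by auto; ring).
    assert (0 <= c (snd a) * qform K l).
    { apply Rmult_le_pos; [apply Hcl, Ha|apply HP, Hl]. }
    assert (0 <= qform (fun i j => Rmin (c' i) (c' j) * K i j) (l1 ++ l2)).
    { apply IH.
      - apply Permutation_length in Hp. simpl in Hp. simpl in En. lia.
      - intros b Hb. auto.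
      - intros b Hb. auto. }
    lra.
Qed.

(** * The Lang-Schroeder-Sturm inequality *)

(* Twice the scalar product of [x - p] and [y - p] in the Euclidean case. *)
Definition gram {X : MetricSpace} (p x y : X) : R :=
  mdist p x ^ 2 + mdist p y ^ 2 - mdist x y ^ 2.

Lemma gram_sym {X : MetricSpace} (p x y : X) : gram p x y = gram p y x.
Proof. unfold gram. rewrite (mdist_sym _ x y). ring. Qed.

Lemma gram_diag {X : MetricSpace} (p x : X) : gram p x x = 2 * mdist p x ^ 2.
Proof. unfold gram. rewrite mdist_refl. ring. Qed.

Lemma gram_ge {X : MetricSpace} (p x y : X) : - (2 * mdist p x * mdist p y) <= gram p x y.
Proof.
  unfold gram. assert (H := mdist_tri _ x p y). rewrite (mdist_sym _ x p) in H.
  assert (H0 := mdist_ge0 _ x y). nra.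
Qed.

Lemma geodesic_dist {X : MetricSpace} (g : R -> X) (p q : X) (s : R) :
  geodesic g p q -> 0 <= s <= 1 -> mdist p (g s) = s * mdist p q.
Proof.
  intros (H0 & _ & H) Hs. rewrite <- H0 at 1. rewrite H by lra.
  rewrite Rabs_left1 by lra. ring.
Qed.

Lemma geodesic_initial {X : MetricSpace} (g : R -> X) (p q : X) (s : R) :
  geodesic g p q -> 0 <= s <= 1 -> geodesic (fun u => g (u * s)) p (g s).
Proof.
  intros Hg Hs. assert (Hd := geodesic_dist g p q s Hg Hs).
  destruct Hg as (H0 & _ & H). split; [|split].
  - rewrite Rmult_0_l. exact H0.
  - rewrite Rmult_1_l. reflexivity.
  - intros u v Hu Hv. rewrite H by nra.
    replace (u * s - v * s) with ((u - v) * s) by ring.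
    rewrite Rabs_mult, (Rabs_pos_eq s), Hd by lra. ring.
Qed.

(** The comparison inequality along [g], rearranged: shortening a side at [p] does not decrease the
    comparison angle there. *)
Lemma gram_shrink (X : MetricSpace) : CBB0 X ->
  forall (p x w : X) (g : R -> X) (s : R), geodesic g p x -> 0 <= s <= 1 ->
  gram p w (g s) <= s * gram p w x.
Proof.
  intros HX p x w g s Hg Hs.
  assert (H := CBB0_concave X HX p x w g s Hg Hs).
  unfold gram. rewrite (geodesic_dist g p x s Hg Hs).
  rewrite (mdist_sym _ w p) in H. nra.
Qed.

(** If every step dropped by at least [eta], the sequence would fall linearly and pass below [b]. *)
Lemma bounded_decreasing_small_gap (k : nat -> R) (b eta : R) :
  0 < eta -> (forall n, b <= k n) -> exists n, k n - k (S n) < eta.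
Proof.
  intros He Hb. apply NNPP. intro N.
  assert (H : forall n, k n <= k O - INR n * eta).
  { induction n as [|n IH]; [simpl; lra|]. rewrite S_INR.
    assert (~ k n - k (S n) < eta) by (intro; apply N; eauto). lra. }
  destruct (INR_unbounded ((k O - b) / eta)) as [n Hn].
  apply (Rmult_gt_compat_r eta) in Hn; [|exact He].
  replace ((k O - b) / eta * eta) with (k O - b) in Hn by (field; lra).
  specialize (H n). specialize (Hb n). lra.
Qed.

(* Close enough to [p] along the two geodesics, the triangle at [p] is almost flat:
   the comparison angle is monotone, hence converges, and the defect from flatness
   is controlled by the change of that angle from one dyadic scale to the next. *)
Lemma almost_flat_triangle (X : MetricSpace) : CBB0 X ->
  forall (p x1 x2 : X) (eta : R), 0 < eta ->
  exists (s : R) (y1 y2 : X), 0 < s <= 1 /\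
    mdist p y1 = s * mdist p x1 /\ mdist p y2 = s * mdist p x2 /\
    (forall w, gram p w y1 <= s * gram p w x1) /\
    (forall w, gram p w y2 <= s * gram p w x2) /\
    forall (g : R -> X) (t : R), geodesic g y1 y2 -> 0 <= t <= 1 ->
      mdist p (g t) ^ 2 <= (1 - t) * mdist p y1 ^ 2 + t * mdist p y2 ^ 2
        - t * (1 - t) * mdist y1 y2 ^ 2 + s ^ 2 * eta.
Proof.
  intros HX p x1 x2 eta He.
  destruct (proj1 HX p x1) as [g1 Hg1]. destruct (proj1 HX p x2) as [g2 Hg2].
  assert (Hr : forall n, 0 < (/ 2) ^ n <= 1).
  { intros n. split; [apply pow_lt; lra|]. rewrite <- (pow1 n). apply pow_incr. lra. }
  (* This is [2 * mdist p x1 * mdist p x2] times the cosine of the comparison angle at [p] at scale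
     [(/ 2) ^ n]. *)
  set (k := fun n => gram p (g1 ((/ 2) ^ n)) (g2 ((/ 2) ^ n)) / ((/ 2) ^ n) ^ 2).
  destruct (bounded_decreasing_small_gap k (- (2 * mdist p x1 * mdist p x2)) (eta / 2))
    as [n Hn]; [lra| |].
  { intros n. unfold k. specialize (Hr n). set (s := (/ 2) ^ n) in *.
    assert (H := gram_ge p (g1 s) (g2 s)).
    rewrite (geodesic_dist g1 p x1), (geodesic_dist g2 p x2) in H by (auto; lra).
    apply (Rmult_le_reg_r (s ^ 2)); [apply pow_lt; lra|].
    replace (gram p (g1 s) (g2 s) / s ^ 2 * s ^ 2) with (gram p (g1 s) (g2 s))
      by (field; lra). nra. }
  assert (Hr' := Hr (S n)). specialize (Hr n).
  set (s := (/ 2) ^ S n) in *.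
  assert (Es : (/ 2) ^ n = 2 * s) by (unfold s; simpl; field).
  unfold k in Hn. fold s in Hn. rewrite Es in Hn, Hr.
  assert (Hs0 : 0 <= s <= 1) by lra. assert (Hs2 : 0 <= 2 * s <= 1) by lra.
  assert (D1 := geodesic_dist g1 p x1 _ Hg1 Hs0).
  assert (D2 := geodesic_dist g2 p x2 _ Hg2 Hs0).
  exists s, (g1 s), (g2 s). split; [lra|]. split; [exact D1|]. split; [exact D2|].
  split; [intro; apply gram_shrink; auto|]. split; [intro; apply gram_shrink; auto|].
  intros g t Hg Ht.
  assert (Half : forall h x, geodesic h p x ->
            geodesic (fun u => h (u * (2 * s))) p (h (2 * s)) /\ h (/ 2 * (2 * s)) = h s).
  { intros h x Hh. split; [eapply geodesic_initial; eauto|]. f_equal. field. }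
  destruct (Half _ _ Hg1) as [G1 E1]. destruct (Half _ _ Hg2) as [G2 E2].
  (* The auxiliary point is [g1 (2 * s)], at twice the scale. [B] bounds [mdist p (g t)] above in
     terms of the distance from [g t] to it, [C] bounds that distance below through [g1 s] and
     [g2 s], and [A] bounds its distance to [g2 s] below. *)
  assert (A := gram_shrink X HX p _ (g1 (2 * s)) _ (/ 2) G2 ltac:(lra)).
  cbn beta in A. rewrite E2 in A.
  assert (B := CBB0_concave X HX p _ (g t) _ (/ 2) G1 ltac:(lra)).
  cbn beta in B. rewrite E1 in B.
  assert (C := CBB0_concave X HX _ _ (g1 (2 * s)) _ t Hg Ht).
  assert (D3 := geodesic_dist g _ _ _ Hg Ht). rewrite mdist_sym in D3.
  assert (D4 := geodesic_dist g1 p x1 _ Hg1 Hs2).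
  assert (D5 : mdist (g1 (2 * s)) (g1 s) = s * mdist p x1).
  { destruct Hg1 as (_ & _ & H). rewrite H by lra. rewrite Rabs_pos_eq by lra. ring. }
  (* The left side is [2 * s ^ 2] times the gap of [k] between the two scales, hence the choice of
     [eta / 2] above. *)
  assert (Hk : / 2 * gram p (g1 (2 * s)) (g2 (2 * s)) - 2 * gram p (g1 s) (g2 s)
               <= s ^ 2 * eta).
  { set (u := gram p (g1 (2 * s)) (g2 (2 * s))) in *.
    set (v := gram p (g1 s) (g2 s)) in *.
    apply (Rmult_lt_compat_l (2 * s ^ 2)) in Hn; [|nra].
    replace (2 * s ^ 2 * (u / (2 * s) ^ 2 - v / s ^ 2)) with (/ 2 * u - 2 * v) in Hn
      by (field; lra). lra. }
  unfold gram in A, Hk.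
  rewrite (mdist_sym _ (g t) p), (mdist_sym _ (g t) (g1 (2 * s))) in B.
  rewrite D3, D4 in B. rewrite D5 in C. rewrite D1, D2 in *. rewrite D4 in *.
  assert (0 <= s ^ 2 * eta) by (assert (0 <= s ^ 2) by apply pow2_ge_0; nra).
  nra.
Qed.

(** In a Euclidean space one takes [L * (m - p) = a * (x1 - p) + b * (x2 - p)]. Here [m] divides an
    almost flat small triangle in the ratio of the weights, and [L = (a + b) / s] undoes the
    contraction towards [p]. *)
Lemma approximate_merge (X : MetricSpace) : CBB0 X ->
  forall (p x1 x2 : X) (a b eps : R), 0 < a -> 0 < b -> 0 < eps ->
  exists (m : X) (L : R), 0 <= L /\
    (forall w, L * gram p w m <= a * gram p w x1 + b * gram p w x2 + eps) /\
    L ^ 2 * gram p m m <=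
      a ^ 2 * gram p x1 x1 + 2 * a * b * gram p x1 x2 + b ^ 2 * gram p x2 x2 + eps.
Proof.
  intros HX p x1 x2 a b eps Ha Hb He.
  set (S := a + b). assert (HS : 0 < S) by (unfold S; lra).
  (* The errors in the two estimates are at most [S * eta] and [2 * S ^ 2 * eta]; their sum is
     [eps]. *)
  set (eta := eps / (S + 2 * S ^ 2)).
  assert (Hden : 0 < S + 2 * S ^ 2) by nra.
  assert (Heta : 0 < eta) by (apply Rdiv_lt_0_compat; auto).
  assert (Eeta : S * eta + 2 * S ^ 2 * eta = eps) by (unfold eta; field; lra).
  destruct (almost_flat_triangle X HX p x1 x2 eta Heta)
    as (s & y1 & y2 & Hs & D1 & D2 & H1 & H2 & Hflat).
  destruct (proj1 HX y1 y2) as [g Hg].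
  set (t := b / S).
  assert (Et : S * t = b) by (unfold t; field; lra).
  assert (Ht : 0 <= t <= 1) by (unfold S in *; split; nra).
  specialize (Hflat g t Hg Ht).
  set (L := S / s). assert (EL : L * s = S) by (unfold L; field; lra).
  assert (HL : 0 < L) by (apply Rdiv_lt_0_compat; lra).
  exists (g t), L. split; [lra|]. split.
  - intros w. assert (C := CBB0_concave X HX _ _ w g t Hg Ht).
    assert (G : gram p w (g t) <=
              (1 - t) * gram p w y1 + t * gram p w y2 + s ^ 2 * eta)
      by (unfold gram; nra).
    specialize (H1 w). specialize (H2 w).
    assert (G' : gram p w (g t) <=
              (1 - t) * (s * gram p w x1) + t * (s * gram p w x2) + s ^ 2 * eta) by nra.
    apply (Rmult_le_compat_l L) in G'; [|lra].
    replace (L * ((1 - t) * (s * gram p w x1) + t * (s * gram p w x2) + s ^ 2 * eta))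
      with ((S - S * t) * gram p w x1 + (S * t) * gram p w x2 + s * (S * eta)) in G'
      by (rewrite <- EL; ring).
    rewrite Et in G'. replace (S - b) with a in G' by (unfold S; ring).
    assert (0 <= S ^ 2 * eta) by nra. assert (0 <= S * eta) by nra. nra.
  - rewrite gram_diag.
    assert (G12 : gram p y1 y2 <= s ^ 2 * gram p x1 x2).
    { assert (A := H2 y1). assert (B := H1 x2).
      rewrite (gram_sym p y1 x2) in A. rewrite (gram_sym p x2 x1) in B. nra. }
    assert (G : mdist p (g t) ^ 2 <= s ^ 2 *
        ((1 - t) ^ 2 * mdist p x1 ^ 2 + t ^ 2 * mdist p x2 ^ 2
         + t * (1 - t) * gram p x1 x2 + eta)).
    { assert (Ed : mdist y1 y2 ^ 2 =
        s ^ 2 * mdist p x1 ^ 2 + s ^ 2 * mdist p x2 ^ 2 - gram p y1 y2)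
        by (unfold gram; rewrite D1, D2; ring).
      rewrite Ed, D1, D2 in Hflat. assert (0 <= t * (1 - t)) by nra. nra. }
    apply (Rmult_le_compat_l (2 * L ^ 2)) in G; [|nra].
    rewrite !gram_diag.
    replace (2 * L ^ 2 * (s ^ 2 *
        ((1 - t) ^ 2 * mdist p x1 ^ 2 + t ^ 2 * mdist p x2 ^ 2
         + t * (1 - t) * gram p x1 x2 + eta)))
      with (2 * ((S - S * t) ^ 2 * mdist p x1 ^ 2 + (S * t) ^ 2 * mdist p x2 ^ 2
         + (S * t) * (S - S * t) * gram p x1 x2) + 2 * S ^ 2 * eta) in G
      by (rewrite <- EL; ring).
    rewrite Et in G. replace (S - b) with a in G by (unfold S; ring).
    assert (0 <= S * eta) by nra. lra.
Qed.

Lemma le0_of_le_eps (x C : R) : (forall eps, 0 < eps -> x <= C * eps) -> x <= 0.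
Proof.
  intros H. apply Rnot_lt_le. intro Hx.
  assert (HC : 0 < Rabs C + 1) by (assert (0 <= Rabs C) by apply Rabs_pos; lra).
  specialize (H (x / 2 / (Rabs C + 1)) ltac:(repeat apply Rdiv_lt_0_compat; lra)).
  set (e := x / 2 / (Rabs C + 1)) in *.
  assert (Ee : (Rabs C + 1) * e = x / 2) by (unfold e; field; lra).
  assert (0 < e) by (unfold e; repeat apply Rdiv_lt_0_compat; lra).
  assert (C <= Rabs C) by apply Rle_abs. nra.
Qed.

(** Induction on the number of points: points of weight zero are dropped, and otherwise the first
    two are merged into one, which raises the form by an arbitrarily small amount at most. *)
Theorem gram_copositive (X : MetricSpace) (p : X) : CBB0 X -> copositive (gram p).
Proof.
  intros HX l. remember (length l) as n eqn:En. revert l En.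
  induction n as [n IH] using lt_wf_ind. intros l En Hl.
  destruct l as [|[a x1] l]; [unfold qform; simpl; lra|].
  assert (Ha : 0 <= a) by (apply (Hl (a, x1)); left; auto).
  assert (Hsym := gram_sym p).
  destruct l as [|[b x2] l].
  { rewrite qform_cons by exact Hsym. unfold qform. simpl. rewrite gram_diag.
    assert (0 <= mdist p x1 ^ 2) by apply pow2_ge_0. nra. }
  assert (Hb : 0 <= b) by (apply (Hl (b, x2)); right; left; auto).
  assert (Hl' : nonneg_weights l) by (intros c Hc; apply Hl; right; right; auto).
  destruct (Rle_lt_or_eq_dec _ _ Ha) as [Ha'|<-].
  2:{ rewrite qform_cons by exact Hsym. simpl fst.
      assert (0 <= qform (gram p) ((b, x2) :: l)); [|nra].
      eapply IH; [|reflexivity|]; [subst n; simpl; lia|].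
      intros c Hc; apply Hl; right; auto. }
  destruct (Rle_lt_or_eq_dec _ _ Hb) as [Hb'|<-].
  2:{ rewrite (qform_perm _ _ _ (perm_swap _ _ _)), qform_cons by exact Hsym. simpl fst.
      assert (0 <= qform (gram p) ((a, x1) :: l)); [|nra].
      eapply IH; [|reflexivity|]; [subst n; simpl; lia|].
      intros c [<-|Hc]; [auto|apply Hl; right; right; auto]. }
  set (sg := lsum l fst).
  (* Merging costs [eps] in the diagonal part and [2 * eps * sg] in the cross terms with the
     remaining points. *)
  apply Ropp_le_cancel. rewrite Ropp_0. apply (le0_of_le_eps _ (1 + 2 * sg)).
  intros eps He.
  destruct (approximate_merge X HX p x1 x2 a b eps Ha' Hb' He) as (m & L & HL & H1 & H2).
  assert (HQ : 0 <= qform (gram p) ((L, m) :: l)).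
  { eapply IH; [|reflexivity|]; [subst n; simpl; lia|].
    intros c [<-|Hc]; auto. }
  rewrite qform_cons in HQ by exact Hsym.
  rewrite !qform_cons by exact Hsym. cbn [fst snd lsum fold_right] in *.
  change (fold_right (fun i s => fst i * gram p x1 (snd i) + s) 0 l)
    with (lsum l (fun i => fst i * gram p x1 (snd i))).
  assert (H : L * lsum l (fun i => fst i * gram p m (snd i)) <=
     a * lsum l (fun i => fst i * gram p x1 (snd i)) +
     b * lsum l (fun i => fst i * gram p x2 (snd i)) + eps * sg).
  { unfold sg. rewrite <- !lsum_scal, <- !lsum_plus. apply lsum_le. intros c Hc.
    specialize (H1 (snd c)). specialize (Hl' c Hc).
    rewrite !(Hsym (snd c)) in H1. nra. }
  nra.
Qed.

(** The factor [Rmin] allows a different squared Lipschitz constant at each index: a pair is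
    compared through the smaller of its two. The excess of the right side dominates the form of
    [gram] weighted by [Rmin], which is copositive. *)
Lemma lang_schroeder_sturm_min (X : MetricSpace) : CBB0 X ->
  forall (p : X) (I : Type) (x : I -> X) (c : I -> R) (l : list (R * I)),
  (forall i, 0 <= c i) -> nonneg_weights l -> lsum l fst = 1 ->
  qform (fun i j => Rmin (c i) (c j) * mdist (x i) (x j) ^ 2) l <=
    2 * lsum l (fun a => fst a * (c (snd a) * mdist p (x (snd a)) ^ 2)).
Proof.
  intros HX p I x c l Hc Hl H1.
  assert (HP : copositive (fun i j => gram p (x i) (x j))).
  { intros l' Hl'. rewrite <- (qform_map (gram p) x).
    apply gram_copositive; [exact HX|].
    intros a Ha. apply in_map_iff in Ha. destruct Ha as (b & <- & Hb). apply Hl', Hb. }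
  apply copositive_min with (c := c) in HP; [|intros; apply gram_sym|exact Hc].
  specialize (HP l Hl).
  rewrite <- (qform_separate (fun i => c i * mdist p (x i) ^ 2) l H1).
  apply Rle_trans with
    (qform (fun i j => Rmin (c i) (c j) * mdist (x i) (x j) ^ 2) l
     + qform (fun i j => Rmin (c i) (c j) * gram p (x i) (x j)) l); [lra|].
  rewrite <- qform_plus. apply qform_le; [exact Hl|]. intros i j. unfold gram.
  assert (Hi := pow2_ge_0 (mdist p (x i))). assert (Hj := pow2_ge_0 (mdist p (x j))).
  assert (Mi := Rmin_l (c i) (c j)). assert (Mj := Rmin_r (c i) (c j)). nra.
Qed.

(** * Intersections of balls in complete CAT(0) spaces *)

Section Balls.
Variables (Y : MetricSpace) (I : Type) (y : I -> Y) (c : I -> R).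
Hypothesis HY : CAT0 Y.

Definition convex_weights (l : list (R * I)) : Prop :=
  nonneg_weights l /\ lsum l fst = 1.

(** The Lagrangian of the system of balls: a common point makes it nonpositive for all nonnegative
    weights, and the converse is a minimax argument. *)
Definition penalty (l : list (R * I)) (z : Y) : R :=
  lsum l (fun a => fst a * (mdist z (y (snd a)) ^ 2 - c (snd a))).

Lemma penalty_convex (l : list (R * I)) (p q : Y) (g : R -> Y) (t : R) :
  convex_weights l -> geodesic g p q -> 0 <= t <= 1 ->
  penalty l (g t) <=
    (1 - t) * penalty l p + t * penalty l q - t * (1 - t) * mdist p q ^ 2.
Proof.
  intros [Hl H1] Hg Ht. unfold penalty. set (D := mdist p q ^ 2).
  apply Rle_trans with (lsum l (fun a =>
    (1 - t) * (fst a * (mdist p (y (snd a)) ^ 2 - c (snd a)))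
    + t * (fst a * (mdist q (y (snd a)) ^ 2 - c (snd a)))
    + - (t * (1 - t) * D) * fst a)).
  2:{ rewrite !lsum_plus, !lsum_scal, H1. apply Req_le. ring. }
  apply lsum_le. intros a Ha. specialize (Hl a Ha).
  assert (C := CAT0_convex Y HY p q (y (snd a)) g t Hg Ht).
  rewrite !(mdist_sym _ (y (snd a))) in C. fold D in C.
  apply (Rmult_le_compat_l (fst a)) in C; [|exact Hl]. lra.
Qed.

(** The lower bound [V - eta] is applied at parameter [t] of the geodesic from [b] to [z], where
    strong convexity bounds the penalty above. *)
Lemma penalty_growth (l : list (R * I)) (V eta : R) (b : Y) (t : R) :
  convex_weights l -> (forall z, V - eta <= penalty l z) -> penalty l b <= V + eta ->
  0 < t <= 1 -> 0 <= eta ->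
  forall z, V - 2 * eta / t + (1 - t) * mdist b z ^ 2 <= penalty l z.
Proof.
  intros Hl HV Hb Ht He z. destruct (proj1 HY b z) as [g Hg].
  assert (C := penalty_convex l b z g t Hl Hg ltac:(lra)).
  specialize (HV (g t)).
  assert (E : 2 * eta / t * t = 2 * eta) by (field; lra).
  apply (Rmult_le_reg_l t); [lra|]. nra.
Qed.

Hypothesis Hc : forall l, convex_weights l ->
  qform (fun i j => mdist (y i) (y j) ^ 2) l <= 2 * lsum l (fun a => fst a * c (snd a)).

(** The penalty is averaged over the centres themselves. By [Hc] the average is at most [C], whereas
    growth around a near-minimiser [b] makes it nearly [2 * V + C], where [V] is the infimum. *)
Lemma penalty_lower_bound_le0 (l : list (R * I)) (v : R) :
  convex_weights l -> (forall z, v <= penalty l z) -> v <= 0.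
Proof.
  intros Hl Hv. apply Rnot_lt_le. intro Hpos.
  assert (Hinh : exists z : Y, True).
  { destruct l as [|a l']; [destruct Hl as [_ H]; simpl in H; lra|].
    exists (y (snd a)). auto. }
  destruct Hinh as [z0 _].
  destruct (completeness (fun v => forall z, v <= penalty l z)) as [V [HV1 HV2]].
  { exists (penalty l z0). intros u Hu. apply Hu. }
  { exists v. exact Hv. }
  assert (HVpos : 0 < V) by (specialize (HV1 v Hv); lra).
  set (C := lsum l (fun a => fst a * c (snd a))).
  assert (HC : 0 <= C).
  { assert (H := Hc l Hl). fold C in H.
    assert (0 <= qform (fun i j => mdist (y i) (y j) ^ 2) l); [|lra].
    apply lsum_ge0. intros a Ha. apply lsum_ge0. intros b Hb.
    apply Rmult_le_pos; [apply Rmult_le_pos; apply Hl; auto|apply pow2_ge_0]. }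
  (* Small enough for the errors [2 * t], [t * (V + C)] and [t ^ 2] to be absorbed by [V];
     near-minimality up to [t ^ 2] turns [2 * eta / t] into [2 * t]. *)
  set (t := Rmin (/ 2) (V / (C + 4))).
  assert (Ht : 0 < t <= / 2).
  { unfold t. split; [apply Rmin_glb_lt; [lra|apply Rdiv_lt_0_compat; lra]|apply Rmin_l]. }
  assert (HtV : t * (C + 4) <= V).
  { assert (H := Rmin_r (/ 2) (V / (C + 4))). fold t in H.
    apply (Rmult_le_compat_r (C + 4)) in H; [|lra].
    replace (V / (C + 4) * (C + 4)) with V in H by (field; lra). exact H. }
  assert (He : 0 < t ^ 2) by nra.
  assert (Hb : exists b, penalty l b <= V + t ^ 2).
  { apply NNPP. intro N. assert (V + t ^ 2 <= V); [|lra].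
    apply HV1. intros z. apply Rnot_lt_le. intro Hz. apply N. exists z. lra. }
  destruct Hb as [b Hb].
  assert (HVlow : forall z, V - t ^ 2 <= penalty l z).
  { intros z. assert (V <= penalty l z); [|lra]. apply HV2. intros u Hu. apply Hu. }
  assert (G := penalty_growth l V (t ^ 2) b t Hl HVlow Hb ltac:(lra) ltac:(lra)).
  replace (2 * t ^ 2 / t) with (2 * t) in G by (field; lra).
  destruct Hl as [Hl H1].
  assert (S : V - 2 * t + (1 - t) * (penalty l b + C) <=
              qform (fun i j => mdist (y i) (y j) ^ 2) l - C).
  { apply Rle_trans with (lsum l (fun a => fst a * penalty l (y (snd a)))).
    - apply Rle_trans with (lsum l (fun a => (V - 2 * t) * fst a + (1 - t) *
        (fst a * (mdist b (y (snd a)) ^ 2 - c (snd a)) + fst a * c (snd a)))).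
      + rewrite lsum_plus, !lsum_scal, lsum_plus, H1. unfold penalty, C. lra.
      + apply lsum_le. intros a Ha. specialize (G (y (snd a))). specialize (Hl a Ha). nra.
    - unfold qform, penalty.
      apply Rle_trans with (lsum l (fun a =>
        lsum l (fun d => fst a * fst d * mdist (y (snd a)) (y (snd d)) ^ 2) + - C * fst a)).
      + apply lsum_le. intros a _. unfold C. apply Req_le.
        replace (- lsum l (fun d => fst d * c (snd d)) * fst a)
          with (- fst a * lsum l (fun d => fst d * c (snd d))) by ring.
        rewrite <- !lsum_scal, <- lsum_plus. apply lsum_ext. intros d _. ring.
      + rewrite lsum_plus, lsum_scal, H1. lra. }
  assert (H := Hc l (conj Hl H1)). fold C in H.
  specialize (HVlow b). nra.
Qed.

Definition scale_weights (s : R) (l : list (R * I)) : list (R * I) :=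
  map (fun a => (s * fst a, snd a)) l.

Lemma penalty_mix (s : R) (l l' : list (R * I)) (z : Y) :
  penalty (scale_weights (1 - s) l ++ scale_weights s l') z =
    (1 - s) * penalty l z + s * penalty l' z.
Proof.
  unfold penalty, scale_weights. rewrite lsum_app, !lsum_map, <- !lsum_scal.
  f_equal; apply lsum_ext; intros a _; simpl; ring.
Qed.

Lemma convex_weights_mix (s : R) (l l' : list (R * I)) :
  0 <= s <= 1 -> convex_weights l -> convex_weights l' ->
  convex_weights (scale_weights (1 - s) l ++ scale_weights s l').
Proof.
  intros Hs [Hl H1] [Hl' H1']. split.
  - intros a Ha. apply in_app_or in Ha.
    destruct Ha as [Ha|Ha]; apply in_map_iff in Ha; destruct Ha as (b & <- & Hb);
      simpl; apply Rmult_le_pos; auto; lra.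
  - unfold scale_weights. rewrite lsum_app, !lsum_map. simpl.
    rewrite !lsum_scal, H1, H1'. ring.
Qed.

Lemma convex_weights_single (i : I) : convex_weights ((1, i) :: nil).
Proof. split; [|simpl; ring]. intros a [<-|[]]. simpl. lra. Qed.

Lemma half_square_sum (u v w : Y) :
  mdist u v ^ 2 <= 2 * (mdist u w ^ 2 + mdist v w ^ 2).
Proof.
  assert (H := mdist_tri _ u w v). rewrite (mdist_sym _ w v) in H.
  assert (H0 := pow_incr _ _ 2 (conj (mdist_ge0 _ u v) H)).
  assert (H1 := pow2_ge_0 (mdist u w - mdist v w)). lra.
Qed.

(* The maximal value [V] of the concave function [l |-> inf_z penalty l z]
   is nonpositive.  Near-minimisers [b] of the penalty of near-maximal weights form
   a Cauchy family by uniform convexity; shifting a little weight to the index [i]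
   cannot raise the value above [V], which forces [b] into the ball of index [i]
   up to a small error. *)
Lemma near_optimal_points (i0 : I) :
  exists good : R -> Y -> Prop,
    (forall eta, 0 < eta -> exists b, good eta b) /\
    (forall eta eta' b b', good eta b -> good eta' b' ->
       mdist b b' ^ 2 <= 16 * (eta + eta')) /\
    (forall eta b i s, 0 < eta -> good eta b -> 0 < s <= / 2 ->
       mdist b (y i) ^ 2 - c i <= 4 * eta / s + 4 * s * mdist b (y i) ^ 2).
Proof.
  set (E := fun v => exists l, convex_weights l /\ forall z, v <= penalty l z).
  destruct (completeness E) as [V [HV1 HV2]].
  { exists 0. intros v (l & Hl & Hv). exact (penalty_lower_bound_le0 l v Hl Hv). }
  { exists (- c i0), ((1, i0) :: nil). split; [apply convex_weights_single|].
    intros z. unfold penalty. simpl. assert (H := pow2_ge_0 (mdist z (y i0))). simpl in H. lra. }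
  assert (HV0 : V <= 0).
  { apply HV2. intros v (l & Hl & Hv). exact (penalty_lower_bound_le0 l v Hl Hv). }
  (* The bound is [penalty_growth] at [t = / 2]. *)
  exists (fun eta b => exists l, convex_weights l /\
            forall z, V - 4 * eta + / 2 * mdist b z ^ 2 <= penalty l z).
  split; [|split].
  - intros eta He.
    assert (HE : exists v, E v /\ V - eta < v).
    { apply NNPP. intro N. assert (V <= V - eta); [|lra].
      apply HV2. intros v Hv. apply Rnot_lt_le. intro. apply N. eauto. }
    destruct HE as (v & (l & Hl & Hv) & Hlt).
    assert (Hb : exists b, penalty l b <= V + eta).
    { apply NNPP. intro N. assert (V + eta <= V); [|lra].
      apply HV1. exists l. split; [exact Hl|]. intros z.
      apply Rnot_lt_le. intro. apply N. exists z. lra. }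
    destruct Hb as [b Hb]. exists b, l. split; [exact Hl|]. intros z.
    assert (G := penalty_growth l V eta b (/ 2) Hl
      ltac:(intro u; specialize (Hv u); lra) Hb ltac:(lra) ltac:(lra) z).
    replace (2 * eta / / 2) with (4 * eta) in G by field. lra.
  - intros eta eta' b b' (l & Hl & H) (l' & Hl' & H').
    (* The equal mixture of both weights has this value as a lower bound, by [half_square_sum]; it
       cannot exceed [V]. *)
    assert (HE : E (V - 2 * (eta + eta') + / 8 * mdist b b' ^ 2)).
    { exists (scale_weights (1 - / 2) l ++ scale_weights (/ 2) l').
      split; [apply convex_weights_mix; auto; lra|]. intros z.
      rewrite penalty_mix. specialize (H z). specialize (H' z).
      assert (S := half_square_sum b b' z). lra. }
    specialize (HV1 _ HE). lra.
  - intros eta b i s He (l & Hl & H) Hs.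
    set (D := mdist b (y i)).
    (* The term [- 4 * s ^ 2 * D ^ 2] is the minimum over [u] of [u ^ 2 / 4 - 2 * s * D * u]. *)
    assert (HE : E ((1 - s) * (V - 4 * eta) - 4 * s ^ 2 * D ^ 2 + s * (D ^ 2 - c i))).
    { exists (scale_weights (1 - s) l ++ scale_weights s ((1, i) :: nil)).
      split; [apply convex_weights_mix; auto using convex_weights_single; lra|]. intros z.
      rewrite penalty_mix. specialize (H z).
      unfold penalty at 2. simpl lsum. cbn [fst snd].
      assert (T := mdist_tri _ b z (y i)). fold D in T.
      assert (D0 : 0 <= D) by apply mdist_ge0.
      set (u := mdist b z) in *. set (w := mdist z (y i)) in *.
      assert (0 <= u) by apply mdist_ge0. assert (0 <= w) by apply mdist_ge0.
      assert (Hw : D ^ 2 - 2 * D * u <= w ^ 2).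
      { destruct (Rle_dec u D); nra. }
      assert (A : (1 - s) * (V - 4 * eta + / 2 * u ^ 2) <= (1 - s) * penalty l z)
        by (apply Rmult_le_compat_l; lra).
      assert (B : s * (D ^ 2 - 2 * D * u) <= s * w ^ 2) by (apply Rmult_le_compat_l; lra).
      assert (0 <= (u - 4 * s * D) ^ 2) by apply pow2_ge_0.
      assert (0 <= (/ 2 - s) * u ^ 2) by (apply Rmult_le_pos; [lra|apply pow2_ge_0]).
      lra. }
    (* What remains on the right includes [s * V], which [HV0] makes nonpositive. *)
    specialize (HV1 _ HE).
    apply (Rmult_le_reg_l s); [lra|].
    replace (s * (4 * eta / s + 4 * s * D ^ 2)) with (4 * eta + 4 * s ^ 2 * D ^ 2)
      by (field; lra).
    nra.
Qed.

(** The common point is the limit of near-optimal points with errors tending to zero. *)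
Theorem balls_intersect : complete Y -> inhabited I ->
  exists z, forall i, mdist z (y i) ^ 2 <= c i.
Proof.
  intros HC [i0].
  destruct (near_optimal_points i0) as (good & Hex & Hcau & Hball).
  set (r := fun n => / (INR n + 1)).
  assert (Hn : forall n, 0 < INR n + 1) by (intro n; assert (H := pos_INR n); lra).
  assert (Hr : forall n, 0 < r n) by (intro n; apply Rinv_0_lt_compat, Hn).
  assert (Hrle : forall N n, (N <= n)%nat -> r n <= r N).
  { intros N n HN. apply le_INR in HN. apply Rinv_le_contravar; [apply Hn|lra]. }
  assert (Hr0 : forall eps, 0 < eps -> exists N, r N < eps).
  { intros eps He. destruct (INR_unbounded (/ eps)) as [N HN]. exists N.
    rewrite <- (Rinv_inv eps). apply Rinv_lt_contravar; [|lra].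
    apply Rmult_lt_0_compat; [apply Rinv_0_lt_compat, He|apply Hn]. }
  destruct (boolp.choice (fun n => Hex (r n) (Hr n))) as [u Hu].
  assert (Huu : forall N m n, (N <= m)%nat -> (N <= n)%nat ->
            mdist (u m) (u n) ^ 2 <= 32 * r N).
  { intros N m n Hm Hn'. assert (H := Hcau _ _ _ _ (Hu m) (Hu n)).
    assert (H1 := Hrle _ _ Hm). assert (H2 := Hrle _ _ Hn'). lra. }
  destruct (HC u) as [z Hz].
  { intros eps He. destruct (Hr0 (eps ^ 2 / 32)) as [N HN]; [nra|].
    exists N. intros m n Hm Hn'. specialize (Huu N m n Hm Hn').
    apply Rnot_le_lt. intro. nra. }
  exists z. intros i. set (D := mdist z (y i)).
  assert (HD : 0 <= D) by apply mdist_ge0.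
  assert (Main : forall s, 0 < s <= / 2 ->
            D ^ 2 - c i <= (2 * D + 7 + 4 * (D + 1) ^ 2) * s).
  (* Taking the error [r n] below [s ^ 2] makes [4 * r n / s], like the other terms, of order
     [s]. *)
  { intros s Hs. destruct (Hz s) as [N1 HN1]; [lra|].
    destruct (Hr0 (s ^ 2)) as [N2 HN2]; [nra|].
    set (n := Nat.max N1 N2).
    specialize (HN1 n (Nat.le_max_l _ _)).
    assert (Hrn := Hrle N2 n (Nat.le_max_r _ _)).
    assert (B := Hball (r n) (u n) i s (Hr n) (Hu n) Hs).
    assert (T1 := mdist_tri _ z (u n) (y i)). assert (T2 := mdist_tri _ (u n) z (y i)).
    rewrite (mdist_sym _ z (u n)) in T1. fold D in T1, T2.
    set (D' := mdist (u n) (y i)) in *.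
    assert (HD' : 0 <= D') by apply mdist_ge0.
    assert (A1 : 4 * r n / s <= 4 * s).
    { apply (Rmult_le_reg_r s); [lra|].
      replace (4 * r n / s * s) with (4 * r n) by (field; lra). nra. }
    assert (A2 : s * D' ^ 2 <= s * (D + 1) ^ 2)
      by (apply Rmult_le_compat_l; [lra|apply pow_incr; lra]).
    assert (A3 : D ^ 2 <= (D' + s) ^ 2) by (apply pow_incr; lra).
    nra. }
  assert (H : D ^ 2 - c i <= 0); [|lra].
  apply (le0_of_le_eps _ (2 * D + 7 + 4 * (D + 1) ^ 2)). intros eps He.
  apply Rle_trans with ((2 * D + 7 + 4 * (D + 1) ^ 2) * Rmin eps (/ 2)).
  - apply Main. split; [apply Rmin_glb_lt; lra|apply Rmin_r].
  - apply Rmult_le_compat_l; [nra|apply Rmin_l].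
Qed.

End Balls.

(** * Simultaneous extension *)

(** Zorn's lemma is applied to the sets whose union with [P0] is a clique, rather than to the
    cliques containing [P0], so that the empty chain is covered too. *)
Lemma maximal_clique (W : Type) (rel : W -> W -> Prop) (P0 : W -> Prop) :
  (forall u v, P0 u -> P0 v -> rel u v) ->
  exists M : W -> Prop, (forall u, P0 u -> M u) /\
    (forall u v, M u -> M v -> rel u v) /\
    forall w, rel w w -> (forall u, M u -> rel u w /\ rel w u) -> M w.
Proof.
  intros H0. set (clique := fun S : W -> Prop => forall u v, S u -> S v -> rel u v).
  destruct (@classical_sets.Zorn_bigcup W (fun S => clique (fun u => P0 u \/ S u)))
    as (A & HA & Hmax).
  { intros F HF Htot u v Hu Hv.
    destruct Hu as [Hu|[S HS Hu]]; destruct Hv as [Hv|[S' HS' Hv]].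
    - auto.
    - apply (HF S' HS'); auto.
    - apply (HF S HS); auto.
    - destruct (Htot S S' HS HS') as [L|L].
      + apply (HF S' HS'); right; [apply L|]; assumption.
      + apply (HF S HS); right; [|apply L]; assumption. }
  exists (fun u => P0 u \/ A u). split; [auto|]. split; [exact HA|].
  intros w Hw Hrel. apply NNPP. intro N.
  apply (Hmax (fun u => A u \/ u = w)).
  - split; [intros u Hu; left; exact Hu|]. intro L. apply N. right. apply L. right. reflexivity.
  - intros u v Hu Hv.
    assert (Split : forall u, P0 u \/ A u \/ u = w -> (P0 u \/ A u) \/ u = w) by tauto.
    apply Split in Hu. apply Split in Hv.
    destruct Hu as [Hu|Eu]; destruct Hv as [Hv|Ev]; subst; auto; apply Hrel; auto.
Qed.

(* Every [k] contributes the constraint of an [ell k]-Lipschitz map at distances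
   [rho g k] and [rho h k] from the maps [g] and [h] whose values are compared. *)
Definition controlled {X Y : MetricSpace} {T : Type} (rho : T -> T -> R) (ell : T -> R)
    (u v : X * T * Y) : Prop :=
  let '(x, g, y) := u in let '(x', h, y') := v in
  forall k, mdist y y' ^ 2 <= ell k ^ 2 * mdist x x' ^ 2 + (rho g k + rho h k).

Section SimultaneousExtension.
Variables (X Y : MetricSpace) (T : Type) (rho : T -> T -> R) (ell : T -> R).
Hypotheses (HX : CBB0 X) (HY : CAT0 Y) (HC : complete Y).
Hypotheses (rho_refl : forall g, rho g g = 0)
  (rho_sym : forall g h, rho g h = rho h g)
  (rho_tri : forall g h k, rho g h <= rho g k + rho k h).

Lemma rho_ge0 (g h : T) : 0 <= rho g h.
Proof.
  assert (H := rho_tri g g h). rewrite rho_refl, (rho_sym h g) in H. lra.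
Qed.

(** Each pair of a point of [M] and a constraint [k] gives one ball for the new value, so the balls
    are indexed by such pairs. *)
Lemma one_point_extension (M : X * T * Y -> Prop) (x : X) (g : T) :
  (exists u, M u) -> (forall u v, M u -> M v -> controlled rho ell u v) ->
  exists y, forall u, M u -> controlled rho ell (x, g, y) u.
Proof.
  intros [u0 Hu0] HM.
  set (I := ({u | M u} * T)%type).
  set (px := fun i : I => fst (fst (proj1_sig (fst i)))).
  set (pg := fun i : I => snd (fst (proj1_sig (fst i)))).
  set (py := fun i : I => snd (proj1_sig (fst i))).
  set (r := fun i : I => rho g (snd i) + rho (pg i) (snd i)).
  set (c := fun i : I => ell (snd i) ^ 2 * mdist x (px i) ^ 2 + r i).
  destruct (balls_intersect Y I py c HY) as [y Hy]; [|exact HC| |].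
  2:{ constructor. exact (exist _ u0 Hu0, g). }
  - intros l [Hl H1].
    assert (S := lang_schroeder_sturm_min X HX x I px (fun i => ell (snd i) ^ 2) l
                   (fun i => pow2_ge_0 _) Hl H1).
    apply Rle_trans with
      (qform (fun i j => Rmin (ell (snd i) ^ 2) (ell (snd j) ^ 2) * mdist (px i) (px j) ^ 2
                         + (r i + r j)) l).
    + apply qform_le; [exact Hl|]. intros [[[[x1 g1] y1] M1] k1] [[[[x2 g2] y2] M2] k2].
      unfold py, px, r, pg. cbn [fst snd proj1_sig].
      assert (C := HM _ _ M1 M2). unfold controlled in C.
      (* Of [k1] and [k2], the constraint with the smaller Lipschitz constant is used; the path
         through the other one and [g] bounds its [rho] terms by [r i + r j]. *)
      assert (A1 := rho_tri g2 k1 k2). assert (A2 := rho_tri k2 k1 g).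
      assert (B1 := rho_tri g1 k2 k1). assert (B2 := rho_tri k1 k2 g).
      rewrite (rho_sym k2 g), (rho_sym k1 g) in *.
      unfold Rmin. destruct Rle_dec.
      * specialize (C k1). lra.
      * specialize (C k2). lra.
    + rewrite qform_plus, qform_separate by exact H1.
      unfold c.
      rewrite (lsum_ext l (fun a => fst a * (ell (snd (snd a)) ^ 2
                 * mdist x (px (snd a)) ^ 2 + r (snd a)))
        (fun a => fst a * (ell (snd (snd a)) ^ 2 * mdist x (px (snd a)) ^ 2)
                  + fst a * r (snd a))) by (intros; ring).
      rewrite lsum_plus. fold I. cbv beta in S. lra.
  - exists y. intros [[x' h] y'] Hu k. exact (Hy (exist _ _ Hu, k)).
Qed.

Theorem simultaneous_extension (P0 : X * T * Y -> Prop) :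
  (exists u, P0 u) -> (forall u v, P0 u -> P0 v -> controlled rho ell u v) ->
  exists F : X -> T -> Y, (forall x g y, P0 (x, g, y) -> F x g = y) /\
    forall x g x' h, controlled rho ell (x, g, F x g) (x', h, F x' h).
Proof.
  intros [u0 Hu0] H0.
  destruct (maximal_clique _ (controlled rho ell) P0 H0) as (M & HM0 & HM & Hmax).
  assert (Hsym : forall u v, controlled rho ell u v -> controlled (X := X) (Y := Y) rho ell v u).
  { intros [[x g] y] [[x' h] y'] H k. specialize (H k).
    rewrite (mdist_sym _ y'), (mdist_sym _ x'). lra. }
  assert (Htot : forall xg : X * T, exists y, M (xg, y)).
  { intros [x g].
    destruct (one_point_extension M x g (ex_intro _ u0 (HM0 _ Hu0)) HM) as [y Hy].
    exists y. apply Hmax; [|auto].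
    intros k. rewrite !mdist_refl. assert (H := rho_ge0 g k).
    assert (0 <= ell k ^ 2) by apply pow2_ge_0. simpl. nra. }
  destruct (boolp.choice Htot) as [F HF].
  exists (fun x g => F (x, g)). split.
  - intros x g y Hy. specialize (HF (x, g)).
    (* For [k = g] the right side vanishes at equal points, so the chosen value is the prescribed
       one. *)
    assert (C := HM _ _ HF (HM0 _ Hy) g). rewrite mdist_refl, rho_refl in C.
    apply mdist_eq0. assert (H := mdist_ge0 _ (F (x, g)) y). nra.
  - intros x g x' h. apply HM; apply HF.
Qed.

End SimultaneousExtension.

(** * Lipschitz constants and a weighted metric on bounded maps *)

Lemma is_Lip_spec {S : Type} (d : S -> S -> R) {Y : MetricSpace} (f : S -> Y) (L : R) :
  (forall x y, 0 <= d x y) -> lipschitz d f -> is_Lip d f L ->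
  0 <= L /\ forall x y, mdist (f x) (f y) <= L * d x y.
Proof.
  intros Hd [L' HL'] [Hub _].
  assert (H0 : 0 <= L) by (apply Hub; left; reflexivity).
  split; [exact H0|]. intros x y.
  destruct (classic (x = y)) as [->|N].
  { rewrite mdist_refl. apply Rmult_le_pos; auto. }
  destruct (Rle_lt_or_eq_dec _ _ (Hd x y)) as [P|P].
  - assert (H : mdist (f x) (f y) / d x y <= L) by (apply Hub; right; eauto).
    apply (Rmult_le_compat_r (d x y)) in H; [|lra].
    replace (mdist (f x) (f y) / d x y * d x y) with (mdist (f x) (f y)) in H
      by (field; lra). exact H.
  (* At distance zero the ratio carries no information; the finite constant [L'] forces equal
     values. *)
  - specialize (HL' x y). rewrite <- P in *. lra.
Qed.

Lemma lip_ratios_le {S : Type} (d : S -> S -> R) {Y : MetricSpace} (f : S -> Y) (L : R) :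
  (forall x y, 0 <= d x y) -> 0 <= L ->
  (forall x y, mdist (f x) (f y) <= L * d x y) ->
  is_upper_bound (lip_ratios d f) L.
Proof.
  intros Hd HL H r [->|(x & y & _ & ->)]; [exact HL|]. specialize (H x y).
  destruct (Rle_lt_or_eq_dec _ _ (Hd x y)) as [P|P].
  - apply (Rmult_le_reg_r (d x y)); [exact P|].
    replace (mdist (f x) (f y) / d x y * d x y) with (mdist (f x) (f y)) by (field; lra).
    exact H.
  - rewrite <- P, Rdiv_0_r. exact HL.
Qed.

Lemma is_Lip_exists {S : Type} (d : S -> S -> R) {Y : MetricSpace} (f : S -> Y) :
  (forall x y, 0 <= d x y) -> lipschitz d f -> exists L, is_Lip d f L.
Proof.
  intros Hd [L HL].
  destruct (completeness (lip_ratios d f)) as [L0 H0].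
  - exists (Rmax 0 L). apply lip_ratios_le; [exact Hd|apply Rmax_l|].
    intros x y. specialize (HL x y). specialize (Hd x y).
    assert (H := Rmax_r 0 L). nra.
  - exists 0. left. reflexivity.
  - exists L0. exact H0.
Qed.

Lemma is_lub_ext (E E' : R -> Prop) (L : R) :
  (forall b, is_upper_bound E b <-> is_upper_bound E' b) -> is_lub E L <-> is_lub E' L.
Proof.
  intros H. unfold is_lub. rewrite (H L).
  split; intros [A B]; (split; [exact A|]); intros b Hb; apply B, H, Hb.
Qed.

(** Both sets of ratios have the same upper bounds: one for [f] is at least [L0], and one for [F]
    restricts to [A]. *)
Lemma is_Lip_extension {X Y : MetricSpace} (A : X -> Prop) (f : sub A -> Y) (F : X -> Y)
    (L0 : R) :
  (forall a, F (proj1_sig a) = f a) -> is_Lip (subdist A) f L0 -> 0 <= L0 ->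
  (forall x y, mdist (F x) (F y) <= L0 * mdist x y) ->
  forall L, is_Lip (subdist A) f L <-> is_Lip (@mdist X) F L.
Proof.
  intros HF [_ HL0] Hpos HLip L. apply is_lub_ext. intros b. split; intros Hb.
  - intros r Hr. apply Rle_trans with L0; [|apply HL0, Hb].
    revert r Hr. apply lip_ratios_le; auto using mdist_ge0.
  - intros r [->|(x & y & _ & ->)]; [apply Hb; left; reflexivity|].
    rewrite <- !HF. unfold subdist.
    (* Distinct elements of [sub A] may share their point and differ in the membership proof; their
       ratio is zero. *)
    destruct (classic (proj1_sig x = proj1_sig y)) as [E|N].
    + rewrite E, mdist_refl. unfold Rdiv. rewrite Rmult_0_l.
      apply Hb. left. reflexivity.
    + apply Hb. right. eauto.
Qed.

(* For vectors of norms [p] and [q] at distance [e] this is comparable with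
   [Rmax p q * e], but unlike the latter it satisfies the triangle inequality. *)
Definition weighted_dist (p q e : R) : R :=
  Rmax p q * (Rmax p q - Rmin p q) + Rmin p q * e.

Lemma weighted_dist_sym (p q e : R) : weighted_dist p q e = weighted_dist q p e.
Proof. unfold weighted_dist. rewrite Rmax_comm, Rmin_comm. reflexivity. Qed.

(** The critical case is [r] below [p] and [q]: the two sides then differ by at least
    [(Rmin p q - r) * (p + q - e)]. *)
Lemma weighted_dist_tri (p q r e e1 e2 : R) :
  0 <= p -> 0 <= q -> 0 <= r -> - e1 <= p - r <= e1 -> - e2 <= r - q <= e2 ->
  e <= e1 + e2 -> e <= p + q ->
  weighted_dist p q e <= weighted_dist p r e1 + weighted_dist r q e2.
Proof.
  intros Hp Hq Hr H1 H2 He Hpq.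
  unfold weighted_dist, Rmax, Rmin. repeat destruct Rle_dec; try lra; nra.
Qed.

Lemma weighted_dist_lower (p q e : R) :
  0 <= p -> 0 <= q -> - e <= p - q <= e -> e <= p + q ->
  4 * q * e + 2 * e ^ 2 <= 16 * weighted_dist p q e.
Proof.
  unfold weighted_dist, Rmax, Rmin. destruct Rle_dec; nra.
Qed.

Lemma weighted_dist_upper (p q e : R) :
  0 <= p -> 0 <= q -> - e <= p - q <= e -> weighted_dist p q e <= (2 * p + e) * e.
Proof.
  unfold weighted_dist, Rmax, Rmin. destruct Rle_dec; nra.
Qed.

Lemma exists_sup {S : Type} (f : S -> R) (M : R) :
  inhabited S -> (forall x, f x <= M) ->
  exists m, (forall x, f x <= m) /\ forall b, (forall x, f x <= b) -> m <= b.
Proof.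
  intros [s] HM.
  destruct (completeness (fun r => exists x, r = f x)) as [m [H1 H2]].
  - exists M. intros r [x ->]. apply HM.
  - exists (f s), s. reflexivity.
  - exists m. split; [intros x; apply H1; eauto|].
    intros b Hb. apply H2. intros r [x ->]. apply Hb.
Qed.

(** Expand [(e1 + u + e2) ^ 2]: the cross term is at most [4 * R0 * (e1 + e2)], and [(e1 + e2) ^ 2]
    at most [2 * e1 ^ 2 + 2 * e2 ^ 2]. *)
Lemma weighted_control_on_domain (L d u e1 e2 R0 p r1 r2 : R) :
  0 <= u -> 0 <= e1 -> 0 <= e2 -> 0 <= p -> u <= L * d -> u <= 2 * R0 -> p <= e1 + u + e2 ->
  4 * R0 * e1 + 2 * e1 ^ 2 <= r1 -> 4 * R0 * e2 + 2 * e2 ^ 2 <= r2 ->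
  p ^ 2 <= L ^ 2 * d ^ 2 + (r1 + r2).
Proof.
  intros Hu He1 He2 Hp Hd HR Hpe H1 H2.
  assert (A : p ^ 2 <= (e1 + u + e2) ^ 2) by (apply pow_incr; lra).
  assert (B : u ^ 2 <= (L * d) ^ 2) by (apply pow_incr; lra).
  assert (C : u * (e1 + e2) <= 2 * R0 * (e1 + e2)) by (apply Rmult_le_compat_r; lra).
  assert (D := pow2_ge_0 (e1 - e2)). nra.
Qed.

(** * The extension operator on bounded Lipschitz maps *)

Theorem theorem3p7 (X Y : MetricSpace) (A : X -> Prop) :
  CBB0 X -> CAT0 Y -> complete Y -> (exists a, A a) ->
  exists beta : Lmap (sub A) (subdist A) Y -> Lmap X (@mdist X) Y,
    sup_continuous beta /\
    forall g : Lmap (sub A) (subdist A) Y,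
      (forall a : sub A, proj1_sig (beta g) (proj1_sig a) = proj1_sig g a) /\
      (forall L, is_Lip (subdist A) (proj1_sig g) L <->
                 is_Lip (@mdist X) (proj1_sig (beta g)) L).
Proof.
  intros HX HY HC [a0' Ha0]. set (a0 := exist A a0' Ha0 : sub A).
  set (T := Lmap (sub A) (subdist A) Y).
  assert (Hin : inhabited (sub A)) by (constructor; exact a0).
  (* If [Y] is empty there are no maps from the nonempty set [A], and [beta] is vacuous. *)
  destruct (classic (exists y : Y, True)) as [[y0 _]|Empty].
  2:{ assert (HT : T -> False) by (intro g; apply Empty; exists (proj1_sig g a0); auto).
      exists (fun g => False_rect _ (HT g)). split; intros g; destruct (HT g). }
  assert (Hcst : exists cst : T, forall a, proj1_sig cst a = y0).
  { unshelve eexists (exist _ (fun _ => y0) _); [|reflexivity].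
    split; [exists y0, 0|exists 0]; intros; rewrite mdist_refl; lra. }
  destruct Hcst as [cst Hcst].
  assert (Hd : forall a b : sub A, 0 <= subdist A a b) by (intros; apply mdist_ge0).
  destruct (boolp.choice (P := fun (g : T) L => is_Lip (subdist A) (proj1_sig g) L)) as [ell Hell].
  { intros g. apply is_Lip_exists; [exact Hd|]. exact (proj2 (proj2_sig g)). }
  assert (Hlip := fun g : T =>
    is_Lip_spec _ _ _ Hd (proj2 (proj2_sig g)) (Hell g)).
  (* [N g] is the size of [g] seen from [y0]; [E] below is the sup metric. *)
  destruct (boolp.choice (P := fun (g : T) m => (forall a, mdist (proj1_sig g a) y0 <= m) /\
      forall b, (forall a, mdist (proj1_sig g a) y0 <= b) -> m <= b)) as [N HN].
  { intros g. destruct (proj1 (proj2_sig g)) as [y1 [M HM]].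
    apply (exists_sup _ (M + mdist y1 y0)); [exact Hin|]. intros a.
    specialize (HM a). assert (H := mdist_tri _ (proj1_sig g a) y1 y0). lra. }
  destruct (boolp.choice (P := fun (gh : T * T) m =>
      (forall a, mdist (proj1_sig (fst gh) a) (proj1_sig (snd gh) a) <= m) /\
      forall b, (forall a, mdist (proj1_sig (fst gh) a) (proj1_sig (snd gh) a) <= b) ->
        m <= b)) as [E HE].
  { intros [g h]. apply (exists_sup _ (N g + N h)); [exact Hin|]. intros a. simpl.
    assert (H := mdist_tri _ (proj1_sig g a) y0 (proj1_sig h a)).
    rewrite (mdist_sym _ y0) in H.
    assert (H1 := proj1 (HN g) a). assert (H2 := proj1 (HN h) a). lra. }
  assert (Esup : forall (g h : T) b, dinf_le (proj1_sig g) (proj1_sig h) b -> E (g, h) <= b)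
    by (intros g h; exact (proj2 (HE (g, h)))).
  assert (N0 : forall g, 0 <= N g).
  { intros g. apply Rle_trans with (2 := proj1 (HN g) a0). apply mdist_ge0. }
  assert (E0 : forall g h, 0 <= E (g, h)).
  { intros g h. apply Rle_trans with (2 := proj1 (HE (g, h)) a0). apply mdist_ge0. }
  assert (Esym : forall g h, E (g, h) = E (h, g)).
  { assert (H : forall g h, E (g, h) <= E (h, g)); [|intros; apply Rle_antisym; auto].
    intros g h. apply (proj2 (HE (g, h))). intros a. simpl. rewrite mdist_sym.
    apply (proj1 (HE (h, g)) a). }
  assert (Erefl : forall g, E (g, g) = 0).
  { intros g. apply Rle_antisym; [|apply E0]. apply (proj2 (HE (g, g))). intros a. simpl.
    rewrite mdist_refl. lra. }
  assert (Etri : forall g h k, E (g, h) <= E (g, k) + E (k, h)).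
  { intros g h k. apply (proj2 (HE (g, h))). intros a. simpl.
    assert (H := mdist_tri _ (proj1_sig g a) (proj1_sig k a) (proj1_sig h a)).
    assert (H1 := proj1 (HE (g, k)) a). assert (H2 := proj1 (HE (k, h)) a).
    simpl in H1, H2. lra. }
  assert (EN : forall g h, E (g, h) <= N g + N h).
  { intros g h. apply (proj2 (HE (g, h))). intros a. simpl.
    assert (H := mdist_tri _ (proj1_sig g a) y0 (proj1_sig h a)).
    rewrite (mdist_sym _ y0) in H.
    assert (H1 := proj1 (HN g) a). assert (H2 := proj1 (HN h) a). lra. }
  assert (NE : forall g h, - E (g, h) <= N g - N h <= E (g, h)).
  { assert (H : forall g h, N g <= N h + E (g, h)).
    { intros g h. apply (proj2 (HN g)). intros a.
      assert (H := mdist_tri _ (proj1_sig g a) (proj1_sig h a) y0).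
      assert (H1 := proj1 (HE (g, h)) a). assert (H2 := proj1 (HN h) a).
      simpl in H1. lra. }
    intros g h. assert (H1 := H g h). assert (H2 := H h g). rewrite Esym in H2.
    lra. }
  set (rho := fun g h : T => 16 * weighted_dist (N g) (N h) (E (g, h))).
  assert (rho_refl : forall g, rho g g = 0).
  { intros g. unfold rho, weighted_dist. rewrite Erefl, Rmax_left, Rmin_left by lra. ring. }
  assert (rho_sym : forall g h, rho g h = rho h g).
  { intros g h. unfold rho. rewrite weighted_dist_sym, Esym. reflexivity. }
  assert (rho_tri : forall g h k, rho g h <= rho g k + rho k h).
  { intros g h k. unfold rho.
    assert (H := weighted_dist_tri (N g) (N h) (N k) (E (g, h)) (E (g, k)) (E (k, h))
      (N0 g) (N0 h) (N0 k) (NE g k) (NE k h) (Etri g h k) (EN g h)). lra. }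
  assert (rho_lower : forall g k, 4 * N k * E (g, k) + 2 * E (g, k) ^ 2 <= rho g k).
  { intros g k. apply weighted_dist_lower; auto. }
  assert (rho_upper : forall g h, rho g h <= 16 * ((2 * N g + E (g, h)) * E (g, h))).
  { intros g h. unfold rho. apply Rmult_le_compat_l; [lra|].
    apply weighted_dist_upper; auto. }
  destruct (simultaneous_extension X Y T rho ell HX HY HC rho_refl rho_sym rho_tri
    (fun u => exists a : sub A,
       fst (fst u) = proj1_sig a /\ snd u = proj1_sig (snd (fst u)) a))
    as (F & HF0 & HF).
  { exists (proj1_sig a0, cst, proj1_sig cst a0), a0. auto. }
  { intros [[x g] y] [[x' h] y']. cbn [fst snd]. intros [a [-> ->]] [b [-> ->]] k.
    set (u := mdist (proj1_sig k a) (proj1_sig k b)).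
    (* The path runs from [g a] through [k a] and [k b] to [h b]. *)
    assert (Hpe : mdist (proj1_sig g a) (proj1_sig h b) <= E (g, k) + u + E (h, k)).
    { assert (H1 := mdist_tri _ (proj1_sig g a) (proj1_sig k a) (proj1_sig h b)).
      assert (H2 := mdist_tri _ (proj1_sig k a) (proj1_sig k b) (proj1_sig h b)).
      assert (H3 := proj1 (HE (g, k)) a). assert (H4 := proj1 (HE (h, k)) b).
      cbn [fst snd] in H3, H4. rewrite (mdist_sym _ (proj1_sig h b)) in H4.
      unfold u. lra. }
    assert (Hu : u <= 2 * N k).
    { assert (H := mdist_tri _ (proj1_sig k a) y0 (proj1_sig k b)).
      rewrite (mdist_sym _ y0) in H.
      assert (H1 := proj1 (HN k) a). assert (H2 := proj1 (HN k) b). unfold u. lra. }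
    apply weighted_control_on_domain with (u := u) (R0 := N k) (e1 := E (g, k)) (e2 := E (h, k));
      [apply mdist_ge0|apply E0|apply E0|apply mdist_ge0| |exact Hu|exact Hpe| |]; auto.
    exact (proj2 (Hlip k) a b). }
  assert (HFlip : forall g x y, mdist (F x g) (F y g) <= ell g * mdist x y).
  { intros g x y. specialize (HF x g y g g). rewrite rho_refl in HF.
    apply sqr_le_inv; [apply Rmult_le_pos; [apply Hlip|apply mdist_ge0]|].
    rewrite Rpow_mult_distr. lra. }
  assert (HFb : forall g : T, Defs.bounded (fun x : X => F x g)).
  { intros g.
    assert (Hk : ell cst = 0).
    { apply Rle_antisym; [|apply Hlip]. apply (Hell cst).
      apply lip_ratios_le; [exact Hd|lra|]. intros a b. rewrite !Hcst, mdist_refl. lra. }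
    (* The constraint for the constant map bounds [m ^ 2] by [2 * rho g cst], and
       [m <= 1 + m ^ 2]. *)
    exists (F a0' g), (1 + 2 * rho g cst). intros x.
    specialize (HF x g a0' g cst). rewrite Hk in HF.
    assert (Hm := mdist_ge0 _ (F x g) (F a0' g)).
    set (m := mdist (F x g) (F a0' g)) in *. nra. }
  assert (HFL : forall g : T, Defs.bounded (fun x : X => F x g) /\
                 lipschitz (@mdist X) (fun x : X => F x g)).
  { intros g. split; [apply HFb|]. exists (ell g). apply HFlip. }
  assert (Hcont : forall (g : T) eps, 0 < eps -> exists delta, 0 < delta /\
      forall h : T, dinf_le (proj1_sig g) (proj1_sig h) delta ->
        dinf_le (fun x : X => F x g) (fun x : X => F x h) eps).
  (* For [delta <= 1], [rho_upper] gives [rho g h <= K * delta], which bounds the squared distance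
     of the extensions. *)
  { intros g eps He. set (K := 16 * (2 * N g + 1)).
    assert (HK : 0 < K) by (unfold K; specialize (N0 g); lra).
    exists (Rmin 1 (eps ^ 2 / K)). split.
    { apply Rmin_glb_lt; [lra|]. apply Rdiv_lt_0_compat; [nra|exact HK]. }
    intros h Hh x.
    set (del := Rmin 1 (eps ^ 2 / K)) in *.
    assert (HEd := Esup g h del Hh).
    assert (Hd1 : del <= 1) by apply Rmin_l.
    assert (Hd2 : del * K <= eps ^ 2).
    { apply Rle_trans with (eps ^ 2 / K * K).
      - apply Rmult_le_compat_r; [lra|apply Rmin_r].
      - apply Req_le. field. lra. }
    apply sqr_le_inv; [lra|].
    specialize (HF x g x h g). rewrite mdist_refl, rho_refl, (rho_sym h g) in HF.
    specialize (rho_upper g h). specialize (E0 g h). specialize (N0 g).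
    set (e := E (g, h)) in *.
    assert ((2 * N g + e) * e <= (2 * N g + 1) * del)
      by (apply Rmult_le_compat; lra).
    unfold K in Hd2. lra. }
  exists (fun g : T => exist _ (fun x : X => F x g) (HFL g)).
  split; [exact Hcont|].
  intros g. cbn [proj1_sig]. split.
  - intros a. apply HF0. exists a. auto.
  - apply is_Lip_extension with (L0 := ell g); auto; [|apply Hlip].
    intros a. apply HF0. exists a. auto.
Qed.
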